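(* Let $m\in\mathbb{N}_+$ be a positive integer. Then $E^{[m]}\subset F^{[m]}_1\subset F^{[m]}$. In particular, for every $f\in E^{[m]}$: if $\mathcal{L}(f^k)=0$ for all $k\in\mathbb{N}_+$, then $f=0$.
   Context: $\mathbb{N}_+$ is the set of positive integers. $\mathbb{C}^{[m]}=\mathbb{C}[X_1,\ldots,X_m]$, and $\mathcal{L}:\mathbb{C}^{[m]}\to\mathbb{C}$ is the $\mathbb{C}$-linear map with $\mathcal{L}(X_1^{l_1}\cdots X_m^{l_m})=l_1!\cdots l_m!$ for all integers $l_1,\ldots,l_m\ge 0$. For $f\in\mathbb{C}^{[m]}$, $\mathcal{N}(f)$ denotes the number of monomials appearing in $f$ with nonzero coefficient. Define $$F^{[m]}=\{f\in\mathbb{C}^{[m]}\setminus\{0\}\,;\,\exists k\in\mathbb{N}_+,\ \mathcal{L}(f^k)\ne 0\}\cup\{0\},$$ $$F_1^{[m]}=\{f\in\mathbb{C}^{[m]}\setminus\{0\}\,;\,\exists k\in\{1,\ldots,\mathcal{N}(f)\},\ \mathcal{L}(f^k)\ne 0\}\cup\{0\},$$ $$E^{[m]}=\{X_1\cdots X_m(\mu_1X_1+\cdots+\mu_mX_m)\,;\,\mu_1,\ldots,\mu_m\in\mathbb{C}\}.$$ *)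

(* Defs.v *)
From HB Require Import structures.
From mathcomp Require Import all_boot all_order all_algebra.
From mathcomp Require Import classical_sets reals.
From mathcomp Require Import complex ssrcomplements mpoly.

Set Implicit Arguments.
Unset Strict Implicit.
Unset Printing Implicit Defensive.

Import GRing.Theory.
Local Open Scope ring_scope.
Local Open Scope classical_set_scope.

(* The field of complex numbers is R[i], for R : realType; the m variables
   are 'X_i for i : 'I_m, i.e., they are numbered from 0 to m - 1. *)

Section FactorialFunctional.
Variables (R : realType) (m : nat).
Implicit Types f : {mpoly R[i][m]}.

Definition L f : R[i] :=
  \sum_(u <- msupp f) f@_u * \prod_(i < m) ((u i)`!)%:R.

Lemma LwE k f : (msize f <= k)%N ->
  L f = \sum_(u : 'X_{1..m < k}) f@_u * \prod_(i < m) ((u i)`!)%:R.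
Proof.
move=> le_fk; set I : subFinType _ := 'X_{1..m < k}.
rewrite /L (big_mksub I) ?msupp_uniq //=; last first.
  by move=> u /msize_mdeg_lt /leq_trans; apply.
by rewrite big_rmcond //= => u /memN_msupp_eq0 ->; rewrite mul0r.
Qed.

(* L is the linear map with the prescribed values on monomials. *)
Lemma L_is_linear : linear_for *%R L.
Proof.
move=> c f g; pose k := maxn (msize (c *: f + g)) (maxn (msize f) (msize g)).
rewrite !(@LwE k) ?leq_max ?leqnn ?orbT // mulr_sumr -big_split /=.
by apply: eq_bigr => u _; rewrite mcoeffD mcoeffZ mulrDl mulrA.
Qed.

HB.instance Definition _ :=
  GRing.isLinear.Build R[i] {mpoly R[i][m]} R[i] *%R L L_is_linear.

Lemma LX (u : 'X_{1..m}) : L 'X_[u] = \prod_(i < m) ((u i)`!)%:R.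
Proof. by rewrite /L msuppX big_seq1 mcoeffX eqxx mul1r. Qed.

Definition nmonomials f : nat := size (msupp f).

Definition F : set {mpoly R[i][m]} :=
  [set f | f <> 0 /\ exists k : nat, (0 < k)%N /\ L (f ^+ k) <> 0]
    `|` [set 0].

Definition F1 : set {mpoly R[i][m]} :=
  [set f | f <> 0 /\
     exists k : nat, (1 <= k <= nmonomials f)%N /\ L (f ^+ k) <> 0]
    `|` [set 0].

Definition E : set {mpoly R[i][m]} :=
  [set f | exists mu : 'I_m -> R[i],
     f = (\prod_(i < m) 'X_i) * \sum_(i < m) mu i *: 'X_i].

End FactorialFunctional.

Arguments F : clear implicits.
Arguments F1 : clear implicits.
Arguments E : clear implicits.

(* Main.v *)
(** Write f = X_1...X_m (mu_1 X_1 + ... + mu_m X_m).  The multinomial theorem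
    gives L (f^k) = (k!)^(m+1) [t^k] P^-(k+1) with
    P = (1 - mu_1 t)...(1 - mu_m t), a polynomial whose degree is at most the
    number of monomials of f.  If f <> 0 then P <> 1; let c t^k be the lowest
    term of P - 1.  Then [t^k] P^-(k+1) = - (k+1) c <> 0. *)
Require Import Defs.
From mathcomp Require Import all_boot all_order all_algebra.
From mathcomp Require Import classical_sets reals.
From mathcomp Require Import complex mpoly.

Local Open Scope ring_scope.
Local Open Scope classical_set_scope.

Import GRing.Theory Num.Theory.

Section PolyCoefficients.
Variable A : comNzRingType.
Implicit Types p q : {poly A}.

(** Serves both sides of [L_exp_E], which then become sums over the same exponent vectors and can be
    compared term by term. *)
Lemma coef_prod_poly_sum m n (c : 'I_m -> nat -> A) k :
  (\prod_(i < m) \poly_(a < n) c i a)`_k =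
  \sum_(a : {ffun 'I_m -> 'I_n} | (\sum_(i < m) a i)%N == k)
    \prod_(i < m) c i (a i).
Proof.
under eq_bigr do rewrite poly_def.
rewrite bigA_distr_bigA coef_sum big_mkcond [RHS]big_mkcond /=.
apply: eq_bigr => a _.
have -> : \prod_(i < m) (c i (a i) *: 'X^(a i)) =
    (\prod_(i < m) c i (a i)) *: 'X^(\sum_(i < m) a i) :> {poly A}.
  elim/big_rec3: _ => [|i x e p _ ->]; first by rewrite scale1r.
  by rewrite exprD -scalerAl -scalerAr scalerA.
by rewrite coefZ coefXn eq_sym; case: eqP; rewrite ?mulr1 ?mulr0.
Qed.

(** Congruence modulo ['X^n], which lets truncated polynomials stand in for power series. *)
Definition eq_coef_lt n p q := forall i, (i < n)%N -> p`_i = q`_i.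

Lemma eq_coef_ltM n p p' q q' :
  eq_coef_lt n p q -> eq_coef_lt n p' q' -> eq_coef_lt n (p * p') (q * q').
Proof.
move=> pq pq' i lt_in; rewrite !coefM; apply: eq_bigr => -[j /= le_ji] _.
by rewrite pq ?pq' // (leq_ltn_trans _ lt_in) ?leq_subr.
Qed.

Lemma eq_coef_ltX1 n p r : eq_coef_lt n p 1 -> eq_coef_lt n (p ^+ r) 1.
Proof.
move=> p1; elim: r => [|r IHr]; first by rewrite expr0.
by rewrite exprS -[1]mul1r; apply: eq_coef_ltM.
Qed.

(** The coefficients of [q] of index strictly between 0 and [k] vanish, so only the two extreme
    terms of the convolution survive. *)
Lemma coefM_eq1 k p q : (0 < k)%N -> eq_coef_lt k q 1 ->
  (p * q)`_k = p`_k + p`_0 * q`_k.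
Proof.
case: k => // k _ q1; rewrite coefM big_ord_recl big_ord_recr /= subn0.
rewrite /bump /= add1n subnn (q1 0%N) // coef1 mulr1 big1 ?add0r 1?addrC //.
by case=> i lt_ik _ /=; rewrite q1 ?coef1 ?subSS ?subn_eq0 ?ltnS ?leq_subr
  // leqNgt lt_ik mulr0.
Qed.

(** This is (1 + c t^k)^r = 1 + r c t^k modulo t^(k+1). *)
Lemma coefX_eq1 k p r : (0 < k)%N -> eq_coef_lt k p 1 ->
  (p ^+ r)`_k = p`_k *+ r.
Proof.
move=> k_gt0 p1; elim: r => [|r IHr].
  by rewrite expr0 coef1 mulr0n; case: k k_gt0 {p1}.
rewrite exprSr coefM_eq1 // IHr (eq_coef_ltX1 k p r p1 0%N k_gt0) coef1 mul1r.
by rewrite mulrSr.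
Qed.

(* A truncation of [(1 - mu t)^-(k+1)]. *)
Definition neg_binomial n k mu : {poly A} :=
  \poly_(a < n) (mu ^+ a *+ 'C(k + a, a)).

(** Induction on [k]: the base case is the geometric series, and by Pascal's rule multiplication by
    [1 - mu *: 'X] lowers [k.+1] to [k]. *)
Lemma neg_binomialP n k mu :
  eq_coef_lt n (neg_binomial n k mu * (1 - mu *: 'X) ^+ k.+1) 1.
Proof.
have step i (c : nat -> A) : (i < n)%N ->
    (\poly_(a < n) c a * (1 - mu *: 'X))`_i =
    c i - (if i is i'.+1 then mu * c i' else 0).
  move=> lt_in; rewrite mulrBr mulr1 -scalerAr coefB coefZ coefMX !coef_poly.
  by rewrite lt_in; case: i lt_in => [|i] lt_in; rewrite ?mulr0 //= ltnW.
elim: k => [|k IHk].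
  rewrite expr1 => -[|i] lt_in; rewrite step // coef1 ?add0n ?bin0 ?subr0 //.
  by rewrite !binn !mulr1n exprS subrr.
rewrite exprS mulrA; move: IHk; set q := _ ^+ k.+1 => IHk.
suff: eq_coef_lt n (neg_binomial n k.+1 mu * (1 - mu *: 'X))
                   (neg_binomial n k mu).
  by move=> eqn i lt_in; rewrite -IHk //; apply: eq_coef_ltM lt_in.
move=> [|i] lt_in; rewrite step // coef_poly lt_in ?bin0 ?subr0 //.
by rewrite mulrnAr -exprS addnS binS mulrnDr addrK addSnnS.
Qed.

End PolyCoefficients.

(** The multinomial theorem in the form exp(y_1) ... exp(y_r) = exp(y_1 + ... + y_r), with
    exponentials truncated at degree [n]; the binomial theorem adds one factor at a time. *)
Lemma coef_prod_exp (K : numFieldType) (B : comAlgType K) (I : Type)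
    (r : seq I) (y : I -> B) n j : (j < n)%N ->
  (\prod_(i <- r) \poly_(a < n) ((a`!)%:R^-1 *: y i ^+ a))`_j =
  (j`!)%:R^-1 *: (\sum_(i <- r) y i) ^+ j.
Proof.
elim: r j => [|i r IHr] j lt_jn.
  rewrite !big_nil coef1 expr0n; case: j lt_jn => [|j] _; last by rewrite scaler0.
  by rewrite invr1 scale1r.
rewrite !big_cons coefM exprDn scaler_sumr.
rewrite (reindex_inj rev_ord_inj) /=; apply: eq_bigr => -[a /=].
rewrite ltnS => le_aj _; rewrite subSS subKn // IHr ?(leq_ltn_trans le_aj) //.
rewrite coef_poly (leq_ltn_trans (leq_subr _ _) lt_jn) -scalerAl -scalerAr.
rewrite scalerA -scaler_nat scalerA.
congr (_ *: _); have fact_neq0 b : (b`!)%:R != 0 :> K.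
  by rewrite pnatr_eq0 -lt0n fact_gt0.
apply: (mulfI (fact_neq0 j)); rewrite mulVKf //.
by rewrite -(bin_fact le_aj) !natrM -mulrA [_%:R^-1 / _]mulrC mulrACA !mulfV ?mulr1.
Qed.

Section ElementsOfE.
Variables (R : realType) (m : nat) (mu : 'I_m -> R[i]).

Local Notation f := ((\prod_(i < m) 'X_i) * \sum_(i < m) mu i *: 'X_i).
Local Notation P := (\prod_(i < m) (1 - mu i *: 'X) : {poly R[i]}).
(** Represents P^-(k+1) modulo ['X^k.+1]. *)
Local Notation H k := (\prod_(i < m) neg_binomial R[i] k.+1 k (mu i)).

(** In the multinomial expansion of f^k, the term of exponents a_i carries k! and, for each
    variable, mu_i^a_i / a_i! times X_i^(k + a_i). Applying [L] turns the latter into (k + a_i)! /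
    a_i! = k! C(k + a_i, a_i), whence m + 1 factors k! in all. *)
Lemma L_exp_E k : L (f ^+ k) = (k`!)%:R ^+ m.+1 * (H k)`_k.
Proof.
have fact_neq0 b : (b`!)%:R != 0 :> R[i] by rewrite pnatr_eq0 -lt0n fact_gt0.
have := coef_prod_exp R[i] {mpoly R[i][m]} 'I_m (index_enum 'I_m)
  (fun i => mu i *: 'X_i) k.+1 k (ltnSn k).
rewrite coef_prod_poly_sum => /(congr1 (fun q => (k`!)%:R *: q)).
rewrite scalerA mulfV // scale1r exprMn => <-.
rewrite coef_prod_poly_sum -scalerAr linearZ /= exprS -mulrA; congr (_ * _).
rewrite !mulr_sumr raddf_sum /=; apply: eq_bigr => a _.
have -> : (k`!)%:R ^+ m = \prod_(i < m) (k`!)%:R :> R[i].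
  by rewrite prodr_const card_ord.
have -> : (\prod_(i < m) 'X_i) ^+ k *
    (\prod_(i < m) (((a i)`!)%:R^-1 *: (mu i *: 'X_i) ^+ a i)) =
    (\prod_(i < m) (((a i)`!)%:R^-1 * mu i ^+ a i)) *:
    'X_[ [multinom (k + a i)%N | i < m] ] :> {mpoly R[i][m]}.
  rewrite mpolyXE_id -prodrXl -scaler_prod -!big_split /=; apply: eq_bigr => i _.
  by rewrite mnmE exprZn scalerA -scalerAr exprD.
rewrite linearZ /= LX -!big_split; apply: eq_bigr => i _ /=; rewrite mnmE.
rewrite -[LHS]mulrA; apply: (mulfI (fact_neq0 (a i))); rewrite mulVKf //.
rewrite -(bin_fact (leq_addl k (a i))) addnK !natrM.
by rewrite [LHS]mulrA [LHS]mulrC [mu i ^+ _ * _]mulr_natr mulrA.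
Qed.

(** The monomials X_1...X_m X_i are pairwise distinct, so each nonzero mu_i contributes one to [f],
    while only these mu_i contribute to the degree of P. *)
Lemma size_prod_linear_le : (size P <= (nmonomials f).+1)%N.
Proof.
pose A : {pred 'I_m} := [pred i | mu i != 0].
pose e (i : 'I_m) := (\sum_(j < m) U_(j) + U_(i))%MM.
have fE : f = \sum_(i < m) mu i *: 'X_[e i].
  rewrite mulr_sumr; apply: eq_bigr => i _.
  by rewrite -scalerAr mprodXE mpolyXD.
have leA : (#|A| <= nmonomials f)%N.
  rewrite cardE /nmonomials -(size_map e).
  have inj : injective e.
    move=> i j /addmI /(congr1 (fun u : 'X_{1..m} => u i)).
    by rewrite !mnm1E eqxx; case: eqP.
  apply: uniq_leq_size; first by rewrite map_inj_uniq ?enum_uniq.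
  move=> _ /mapP[i + ->]; rewrite mem_enum inE => mui_neq0.
  rewrite mcoeff_msupp fE raddf_sum (bigD1 i) //= big1 => [|j ji].
    by rewrite mcoeffZ mcoeffX eqxx mulr1 addr0.
  by rewrite mcoeffZ mcoeffX (inj_eq inj) (negPf ji) mulr0.
have -> : P = \prod_(i in A) (1 - mu i *: 'X).
  rewrite (bigID (mem A)) /= [X in _ * X]big1 ?mulr1 // => i.
  by rewrite inE negbK => /eqP ->; rewrite scale0r subr0.
(* Each factor has size at most 2, so the product has size at most (2 |A| + 1) - |A| = |A| + 1. *)
apply: leq_trans (size_poly_prod_leq _ _) _.
rewrite leq_subLR addnS ltnS.
apply: (@leq_trans (#|A| * 2)%N); last by rewrite muln2 -addnn leq_add2l.
rewrite -sum_nat_const leq_sum // => i _.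
rewrite (leq_trans (size_polyD _ _)) // size_polyN size_poly1 geq_max /=.
by rewrite (leq_trans (size_scale_leq _ _)) ?size_polyX.
Qed.

Lemma F1_elementE : F1 R m f.
Proof.
have [/forallP /= mu0 | /forallPn /= [i0 mui0]] := boolP [forall i, mu i == 0].
  by right; rewrite /= [X in _ * X]big1 ?mulr0 // => i _; rewrite (eqP (mu0 i)) scale0r.
(* P vanishes at the inverse of mu_i0, where 1 does not. *)
have P_neq1 : P != 1.
  apply/eqP => /(congr1 (fun p => p.[(mu i0)^-1])) /eqP.
  rewrite hornerC horner_prod (bigD1 i0) //= !hornerE mulfV // subrr mul0r.
  by rewrite eq_sym oner_eq0.
have exk : exists k, P`_k != (1 : {poly R[i]})`_k.
  pose n := maxn (size P) (size (1 : {poly R[i]})).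
  have [/forallP eqP1 | /forallPn /= [k neqk]] :=
    boolP [forall k : 'I_n, P`_k == (1 : {poly R[i]})`_k]; last by exists k.
  case/eqP: P_neq1; apply/polyP => k.
  have [lt_kn | ] := ltnP k n; first exact/eqP/(eqP1 (Ordinal lt_kn)).
  by rewrite geq_max => /andP[? ?]; rewrite !nth_default.
(* The least such [k] is the order of P - 1 at 0. *)
case: (ex_minnP exk) => k neqk min_k.
have P1 : eq_coef_lt R[i] k P 1.
  by move=> i lt_ik; apply/eqP; apply: contraLR lt_ik => /min_k; rewrite -leqNgt.
have P0 : P`_0 = 1.
  rewrite -horner_coef0 horner_prod big1 // => i _.
  by rewrite !hornerE ?mulr0 ?subr0.
have k_gt0 : (0 < k)%N by case: k neqk {min_k P1} => //; rewrite P0 coef1 eqxx.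
have Pk_neq0 : P`_k != 0 by move: neqk; rewrite coef1 eqn0Ngt k_gt0.
have le_kN : (k <= nmonomials f)%N.
  rewrite -ltnS (leq_trans _ size_prod_linear_le) // ltnNge.
  by apply: contraNN Pk_neq0 => /leq_sizeP/(_ k (leqnn k)) ->.
have HP : eq_coef_lt R[i] k.+1 (H k * P ^+ k.+1) 1.
  rewrite -prodrXl -big_split; elim/big_ind: _ => //= [p q p1 q1 | i _].
    by rewrite -[1]mul1r; apply: eq_coef_ltM.
  exact: neg_binomialP.
have H0 : (H k)`_0 = 1.
  rewrite -horner_coef0 horner_prod big1 // => i _.
  by rewrite horner_coef0 coef_poly expr0 bin0.
(* Comparing coefficients of index [k] in H P^(k+1) = 1 gives H_k + (k+1) P_k = 0, and (k+1) P_k is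
   nonzero in characteristic 0. *)
have Lk : L (f ^+ k) != 0.
  have := HP k (ltnSn k); rewrite coefM_eq1 //; last exact: eq_coef_ltX1.
  rewrite coefX_eq1 // H0 mul1r coef1 eqn0Ngt k_gt0 => /eqP.
  rewrite addr_eq0 L_exp_E mulf_eq0 expf_eq0 pnatr_eq0 [_`! == _]eqn0Ngt fact_gt0 /= => /eqP ->.
  by rewrite oppr_eq0 mulrn_eq0.
left; split; last by exists k; rewrite k_gt0; split=> //; apply/eqP.
by move=> f0; move: Lk; rewrite f0 expr0n eqn0Ngt k_gt0 raddf0 eqxx.
Qed.

End ElementsOfE.

Lemma F1_sub_F (R : realType) (m : nat) : F1 R m `<=` F R m.
Proof.
by move=> f [[f_neq0 [k [/andP[k_gt0 _] Lk]]] | ->]; [left; split; last exists k | right].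
Qed.

Theorem corollary2p28 (R : realType) (m : nat) (m_gt0 : (0 < m)%N) :
  (E R m `<=` F1 R m /\ F1 R m `<=` F R m) /\
  (forall f : {mpoly R[i][m]}, E R m f ->
     (forall k : nat, (0 < k)%N -> L (f ^+ k) = 0) -> f = 0).
Proof.
have EF1 : E R m `<=` F1 R m by move=> _ [mu ->]; apply: F1_elementE.
split=> [|f /EF1 /F1_sub_F [[_ [k [k_gt0 Lk]]] Lf | -> //]].
  by split=> //; apply: F1_sub_F.
by case: Lk; apply: Lf.
Qed.
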